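(* Let $(F_j)$ be a sequence of functions on normalized cylinders. If $F_j^2\to0$ in $L^1_{\rm loc}(d\mu_5\,dt)$, then for every $m>7/2$, $$\partial_z(F_j^2)\to0\quad\text{in }L^1_tH^{-m}_{\rm loc}(\mathbb R^5).$$
   Context: Functions $F_j=F_j(r,z,t)$ are identified with functions of $(y,z,t)$, $(y,z)\in\mathbb R^4\times\mathbb R$, radial in $y$ with $r=|y|$; $d\mu_5=r^3\,dr\,dz$. The normalized cylinders are a fixed lifted spacetime cylinder $\{r<1,\ |z|<1\}\times I$ on which all $F_j$ are defined. $L^1_{\rm loc}(d\mu_5\,dt)$ convergence means convergence in $L^1$ on each compact subcylinder (including the axis $r=0$). Convergence to $0$ in $L^1_tH^{-m}_{\rm loc}$ means that for every spatial cutoff $\chi\in C_c^\infty$ in the cylinder and every compact time subinterval $J\subset I$, $\int_J\|\chi\,\partial_z(F_j^2)(t)\|_{H^{-m}(\mathbb R^5)}\,dt\to0$. *)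

(* Defs.v *)
From HB Require Import structures.
From mathcomp Require Import all_boot all_order all_algebra.
From mathcomp Require Import all_classical all_reals all_analysis.
Import Order.TTheory GRing.Theory Num.Theory.
Import numFieldNormedType.Exports.

Set Implicit Arguments.
Unset Strict Implicit.
Unset Printing Implicit Defensive.

Local Open Scope classical_set_scope.
Local Open Scope ring_scope.

(* Points of R^5 are pairs (y, z), with y in R^4. These are notations, so that
   the product topology, norm and sigma-algebra are inferred. *)
Notation R3 R := (R * R * R)%type.
Notation R4 R := (R * R * R * R)%type.
Notation R5 R := (R4 R * R)%type.

(* The product measure m1 \x m2, packaged with its sigma-finiteness: the
   library's instance for it is not found by inference. *)
Section sigma_finite_product.
Context d1 d2 (T1 : measurableType d1) (T2 : measurableType d2) (R : realType).
Variable m1 : {sigma_finite_measure set T1 -> \bar R}.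
Variable m2 : {sigma_finite_measure set T2 -> \bar R}.

Lemma sigma_finite_product : sigma_finite setT (m1 \x m2)%E.
Proof.
have /sigma_finiteP[F [TF ndF Foo]] := sigma_finiteT m1.
have /sigma_finiteP[G [TG ndG Goo]] := sigma_finiteT m2.
exists (fun n => F n `*` G n).
  rewrite -setXTT TF TG predeqE => -[x y]; split.
    move=> [/= [n _ Fnx] [k _ Gky]]; exists (maxn n k) => //; split.
    - by move: x Fnx; exact/subsetPset/ndF/leq_maxl.
    - by move: y Gky; exact/subsetPset/ndG/leq_maxr.
  by move=> [n _ []/= ? ?]; split; exists n.
move=> k; have [? ?] := Foo k; have [? ?] := Goo k.
split; first exact: measurableX.
by rewrite product_measure1E// lte_mul_pinfty// ge0_fin_numE.
Qed.

Definition prod_measure : {sigma_finite_measure set (T1 * T2)%type -> \bar R} :=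
  HB.pack (m1 \x m2)%E
    (Measure_isSigmaFinite.Build _ _ _ (m1 \x m2)%E sigma_finite_product).

End sigma_finite_product.

Section defs.
Variable R : realType.

(* The library's Lebesgue measure lives on measurableTypeR R, a copy of R with
   its Borel sigma-algebra. *)
Local Notation M := (measurableTypeR R).
Definition leb1 : {sigma_finite_measure set M -> \bar R} := lebesgue_measure.
Definition leb3 : {sigma_finite_measure set (R3 M) -> \bar R} :=
  prod_measure (prod_measure leb1 leb1) leb1.
Definition leb4 : {sigma_finite_measure set (R4 M) -> \bar R} :=
  prod_measure leb3 leb1.
Definition leb5 : {sigma_finite_measure set (R5 M) -> \bar R} :=
  prod_measure leb4 leb1.

Definition dot4 (x y : R4 R) : R :=
  x.1.1.1 * y.1.1.1 + x.1.1.2 * y.1.1.2 + x.1.2 * y.1.2 + x.2 * y.2.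
Definition dot5 (x y : R5 R) : R := dot4 x.1 y.1 + x.2 * y.2.

(* The canonical norm of a product type is a maximum, hence this one. *)
Definition norm4 (y : R4 R) : R := Num.sqrt (dot4 y y).

Definition cylinder : set (R5 R) :=
  [set x | norm4 x.1 < 1 /\ -1 < x.2 < 1].

(* C^oo: the iterated derivatives, being differentiable, are continuous. *)
Definition smooth (f : R5 R -> R) :=
  forall (vs : seq (R5 R)) (x : R5 R),
    differentiable (foldr (fun v (g : R5 R -> R) => 'D_v g) f vs) x.

Definition tsupp (f : R5 R -> R) : set (R5 R) :=
  closure [set x | f x != 0].

Definition cutoff (chi : R5 R -> R) :=
  [/\ smooth chi, compact (tsupp chi) & tsupp chi `<=` cylinder].

(* A distribution is represented by its action on real test functions; only
   the values on smooth functions (compactly supported in the cylinder, or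
   arbitrary once multiplied by a cutoff) are meaningful. *)
Definition distr := (R5 R -> R) -> R.

Definition distr_of_fun (g : R5 R -> R) : distr :=
  fun phi => \int[leb5]_(x in cylinder) (g x * phi x).

Definition dz (T : distr) : distr :=
  fun phi => - T ('D_((0, 1) : R5 R) phi).

Definition cutoff_mul (chi : R5 R -> R) (T : distr) : distr :=
  fun phi => T (fun x => chi x * phi x).

(* For compactly supported T, the Fourier transform is the function
   xi |-> T (exp (- i <xi, x>)); as T is real, its real and imaginary parts are
   T (cos <xi, x>) and - T (sin <xi, x>). *)
Definition fourier_sqnorm (T : distr) (xi : R5 R) : R :=
  T (fun x => cos (dot5 xi x)) ^+ 2 + T (fun x => sin (dot5 xi x)) ^+ 2.

(* The H^s norm, up to the constant factor set by the normalization of the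
   Fourier transform. *)
Definition sobolev_norm (s : R) (T : distr) : \bar R :=
  ((\int[leb5]_xi ((1 + dot5 xi xi) `^ s * fourier_sqnorm T xi)%:E)
     `^ (2^-1))%E.

Definition subcylinder (rho z1 z2 a b : R) : set (R3 R) :=
  [set p | 0 <= p.1.1 <= rho /\ z1 <= p.1.2 <= z2 /\ a <= p.2 <= b].

(* Convergence to 0 in L^1_loc(r^3 dr dz dt), in the coordinates (r, z, t). *)
Definition L1loc_cvg0 (I : interval R) (f : nat -> R3 R -> R) :=
  forall rho z1 z2 a b : R,
    0 < rho < 1 -> -1 < z1 -> z1 <= z2 -> z2 < 1 ->
    a <= b -> [set` `[a, b]] `<=` [set` I] ->
    let K : set (R3 M) := subcylinder rho z1 z2 a b in
    [/\ forall j, measurable_fun K (f j),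
        forall j, leb3.-integrable K (fun p => (f j p * p.1.1 ^+ 3)%:E) &
        (\int[leb3]_(p in K) (`|f j p| * p.1.1 ^+ 3)%:E)%E
          @[j --> \oo] --> 0%E].

(* Integrability in time is stated so that the norm is known to be a measurable
   function of t. *)
Definition L1H_loc_cvg0 (s : R) (I : interval R) (T : nat -> R -> distr) :=
  forall (chi : R5 R -> R) (a b : R),
    cutoff chi -> a <= b -> [set` `[a, b]] `<=` [set` I] ->
    (forall j, leb1.-integrable `[a, b]
       (fun t => sobolev_norm s (cutoff_mul chi (T j t)))) /\
    (\int[leb1]_(t in `[a, b]) sobolev_norm s (cutoff_mul chi (T j t)))%E
      @[j --> \oo] --> 0%E.

Definition radial_lift (f : R3 R -> R) (t : R) : R5 R -> R :=
  fun x => f (norm4 x.1, x.2, t).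

End defs.

(* Main.v *)
Require Import Defs.
From HB Require Import structures.
From mathcomp Require Import all_boot all_order all_algebra.
From mathcomp Require Import all_classical all_reals all_analysis.
From mathcomp Require Import measurable_realfun.
From mathcomp Require Import ring lra.
Import Order.TTheory GRing.Theory Num.Theory.
Import numFieldNormedType.Exports.

Set Implicit Arguments.
Unset Strict Implicit.
Unset Printing Implicit Defensive.

(* Put A(t) for the L^1 norm over a compact subcylinder of the lift of f = F_j^2
   at time t. The Fourier transform of chi dz f is minus the pairing of f with
   dz (chi exp (-i <xi, x>)), which is supported in such a subcylinder and
   bounded by C (1 + |xi|); hence it is O((1 + |xi|) A(t)). As 2 (m - 1) > 5,
   the weight (1 + |xi|^2)^(1 - m) is integrable on R^5, so the H^(-m) norm is
   O(A(t)). Polar coordinates in R^4 turn the time integral of A into the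
   L^1(r^3 dr dz dt) norm of f. *)

(** The hypothesis makes [F j p ^+ 2] measurable on compact subcylinders only, while the conclusion
    asks for integrability, hence measurability, in time of a norm built from integrals over the
    whole open cylinder. So f is replaced by its extension by zero from one compact subcylinder K
    that holds the support of the cutoff at all times considered. The Sobolev norm is unchanged for
    these times, and the extension is measurable everywhere, which makes the pairings jointly
    measurable in (xi, t). The estimates hold for every t, without discarding a null set: [fine]
    sends an infinite integral to 0, and where A(t) is infinite the bound is trivial. The polar
    formula uses no change of variables. Scaling gives the volume c r^4 of a ball, and the
    distribution of the radius is determined by these volumes; c itself stays an unevaluated
    constant. The integrability on R^5 avoids polar coordinates, since 1 + |xi|^2 dominates each 1 +
    xi_i^2. *)

Local Open Scope classical_set_scope.
Local Open Scope ring_scope.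

(** * Borel sets of R^5 *)

(* A topological space T and a measurable space M are kept apart, related by
   e : M -> T, because a product of Borel sigma-algebras and a product topology
   live on different structures over the same carrier. *)
Definition countable_measurable_basis (T : topologicalType) d
    (M : measurableType d) (e : M -> T) :=
  exists (I : countType) (B : I -> set M), (forall i, measurable (B i)) /\
    forall U : set T, open U -> forall x, U (e x) ->
      exists i, B i x /\ B i `<=` e @^-1` U.

(** An open set is the union of the members of the family that it contains, and there are countably
    many. The members must be measurable but may fail to be open. *)
Lemma countable_measurable_basis_open (T : topologicalType) d
    (M : measurableType d) (e : M -> T) :
  countable_measurable_basis e ->
  forall U : set T, open U -> measurable (e @^-1` U).
Proof.
move=> [I [B [mB BU]]] U oU.
have -> : e @^-1` U = \bigcup_(i in [set i | B i `<=` e @^-1` U]) B i.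
  apply/seteqP; split => [x Ux|x [i Bi]]; last exact: Bi.
  by have [i [Bx Bi]] := BU U oU x Ux; exists i.
rewrite bigcup_mkcond; apply: countable_bigcupT_measurable => // i.
by case: ifP.
Qed.

Lemma countable_measurable_basis_prod (T1 T2 : topologicalType) d1 d2
    (M1 : measurableType d1) (M2 : measurableType d2)
    (e1 : M1 -> T1) (e2 : M2 -> T2) :
  countable_measurable_basis e1 -> countable_measurable_basis e2 ->
  countable_measurable_basis
    (fun p : M1 * M2 => (e1 p.1, e2 p.2) : (T1 * T2)%type).
Proof.
move=> [I1 [B1 [mB1 BU1]]] [I2 [B2 [mB2 BU2]]].
exists (I1 * I2)%type, (fun i => B1 i.1 `*` B2 i.2); split.
  by move=> i; exact: measurableX.
move=> U oU [x1 x2] /= Ux.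
have : nbhs (e1 x1, e2 x2) U by exact: open_nbhs_nbhs.
case=> [[V1 V2] /= [nV1 nV2] V12].
rewrite nbhsE in nV1; rewrite nbhsE in nV2.
have [W1 [oW1 W1x] W1V] := nV1; have [W2 [oW2 W2x] W2V] := nV2.
have [i1 [Bi1 BW1]] := BU1 W1 oW1 x1 W1x.
have [i2 [Bi2 BW2]] := BU2 W2 oW2 x2 W2x.
exists (i1, i2); split => //= -[y1 y2] /= [By1 By2]; apply: V12; split => /=.
- exact/W1V/BW1.
- exact/W2V/BW2.
Qed.

Lemma countable_measurable_basis_real (R : realType) :
  countable_measurable_basis (fun x : measurableTypeR R => x : R).
Proof.
exists (rat * rat)%type, (fun i => `]ratr i.1, ratr i.2[%classic); split.
  move=> i; exact: (@measurable_itv R).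
move=> U oU x Ux.
have : nbhs (x : R) U by exact: open_nbhs_nbhs.
move=> /nbhs_ballP[e /= e0 eU].
have [q1] := @rat_in_itvoo R (x - e) x ltac:(by rewrite ltrBlDr ltrDl).
have [q2] := @rat_in_itvoo R x (x + e) ltac:(by rewrite ltrDl).
rewrite !in_itv/= => /andP[xq2 q2e] /andP[eq1 q1x].
exists (q1, q2) => /=; split; first by rewrite in_itv/= q1x.
move=> y /=; rewrite in_itv/= => /andP[q1y yq2]; apply: eU.
rewrite /ball /= ltr_norml; apply/andP; split.
  by rewrite ltrBrDr addrC ltrBlDr addrC (lt_trans yq2)// addrC.
by rewrite ltrBlDr -ltrBlDl (lt_trans eq1).
Qed.

(** Cutoffs and their derivatives are continuous for the product topology; the integrals need them
    measurable for the product of the Borel sigma-algebras. Boxes with rational endpoints link the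
    two. *)
Lemma continuous_measurable_R5 (R : realType) (f : R5 R -> R) : continuous f ->
  measurable_fun setT (f : R5 (measurableTypeR R) -> R).
Proof.
move=> cf; have b1 := countable_measurable_basis_real R.
have b := countable_measurable_basis_open
  (countable_measurable_basis_prod (countable_measurable_basis_prod
    (countable_measurable_basis_prod (countable_measurable_basis_prod b1 b1)
     b1) b1) b1).
apply: (measurability _ (RGenOpens.measurableE R)) => //.
move=> _ [_ [x [y ->]] <-]; rewrite setTI.
have := b (f @^-1` `]x, y[) (open_comp (fun z _ => cf z) (itv_open _ _)).
by congr measurable; apply/seteqP; split => -[[[[? ?] ?] ?] ?].
Qed.

(** * Polar coordinates in R^4 *)

Section density.
Local Open Scope ereal_scope.
Context d (T : measurableType d) (R : realType).
Variables (mu : {measure set T -> \bar R}) (w : T -> R).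
Hypotheses (mw : measurable_fun setT w) (w0 : forall x, (0 <= w x)%R).

Let mEw : measurable_fun setT (EFin \o w). Proof. exact/measurable_EFinP. Qed.

Definition density_fun (A : set T) : \bar R := \int[mu]_(x in A) (w x)%:E.

Let density0 : density_fun set0 = 0.
Proof. exact: integral_set0. Qed.

Let density_ge0 A : 0 <= density_fun A.
Proof. by apply: integral_ge0 => x _; rewrite lee_fin. Qed.

Let density_sigma_additive : semi_sigma_additive density_fun.
Proof.
move=> F mF tF mUF; rewrite /density_fun; apply: cvg_toP.
  apply: ereal_nondecreasing_is_cvgn => m n mn.
  apply: lee_sum_nneg_natr => // k _ _; apply: integral_ge0 => x _.
  by rewrite lee_fin.
rewrite ge0_integral_bigcup//=; first exact: measurable_funTS.
by move=> x _; rewrite lee_fin.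
Qed.

HB.instance Definition _ := isMeasure.Build _ _ _ density_fun
  density0 density_ge0 density_sigma_additive.

Definition density_measure : {measure set T -> \bar R} := density_fun.

Import HBNNSimple.

(** Both sides commute with increasing limits and finite sums, so simple functions, and then
    indicators, decide; for an indicator this is the definition of the measure. *)
Lemma ge0_integral_density_measure (f : T -> \bar R) :
  measurable_fun setT f -> (forall x, 0 <= f x) ->
  \int[density_measure]_x f x = \int[mu]_x (f x * (w x)%:E).
Proof.
move=> mf f0; pose f_ := nnsfun_approx measurableT mf.
transitivity (limn (fun n => \int[density_measure]_x (f_ n x)%:E)).
  rewrite -monotone_convergence//.
  - by apply: eq_integral => x _; apply/esym/cvg_lim => //;
      exact: cvg_nnsfun_approx.
  - by move=> n; exact/measurable_EFinP.
  - by move=> n x _; rewrite lee_fin.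
  - by move=> x _ m n mn; rewrite lee_fin; exact/lefP/nd_nnsfun_approx.
have -> : \int[mu]_x (f x * (w x)%:E) =
    limn (fun n => \int[mu]_x ((f_ n x)%:E * (w x)%:E)).
  rewrite -monotone_convergence//.
  - apply: eq_integral => x _; apply/esym/cvg_lim => //.
    by apply: cvgeZr => //; exact: cvg_nnsfun_approx.
  - move=> n; apply: emeasurable_funM => //; exact/measurable_EFinP.
  - by move=> n x _; rewrite mule_ge0// lee_fin.
  - move=> x _ m n mn; rewrite lee_wpmul2r ?lee_fin//.
    exact/lefP/nd_nnsfun_approx.
suff E n : \int[density_measure]_x (f_ n x)%:E =
    \int[mu]_x ((f_ n x)%:E * (w x)%:E) by under eq_fun do rewrite E.
transitivity (\sum_(k \in range (f_ n))
    \int[density_measure]_x (k * \1_(f_ n @^-1` [set k]) x)%:E).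
  under eq_integral do rewrite fimfunE -fsumEFin//.
  rewrite ge0_integral_fsum//.
  - by move=> y; exact/measurable_EFinP/measurable_funM.
  - by move=> y x _; rewrite nnfun_muleindic_ge0.
transitivity (\sum_(k \in range (f_ n))
    \int[mu]_x ((k * \1_(f_ n @^-1` [set k]) x)%:E * (w x)%:E)).
  apply: eq_fsbigr => r; rewrite inE => -[x0 _ <-{r}].
  rewrite integralZl_indic_nnsfun// integral_indic// setIT.
  rewrite /density_measure /density_fun.
  under [RHS]eq_integral do rewrite EFinM -muleA.
  rewrite ge0_integralZl ?lee_fin//.
  - congr (_ * _); rewrite /= /density_measure /density_fun integral_mkcond.
    by apply: eq_integral => x _; rewrite epatch_indic muleC.
  - by apply: emeasurable_funM => //; exact/measurable_EFinP.
  - by move=> x _; rewrite mule_ge0 ?lee_fin.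
rewrite -ge0_integral_fsum//.
- apply: eq_integral => x _.
  rewrite -ge0_mule_fsuml; last by move=> r; rewrite nnfun_muleindic_ge0.
  by rewrite fsumEFin// -fimfunE.
- move=> r; apply: emeasurable_funM => //.
  exact/measurable_EFinP/measurable_funM.
- by move=> r x _; apply: mule_ge0;
    [exact: nnfun_muleindic_ge0|rewrite lee_fin].
Qed.

End density.

(* The measure structure of pushforward depends on the measurability of f,
   which inference cannot find. *)
Definition pushforward_measure d1 d2 (T1 : measurableType d1)
    (T2 : measurableType d2) (R : realType) (m : {measure set T1 -> \bar R})
    (f : T1 -> T2) (mf : measurable_fun setT f) :
    {measure set T2 -> \bar R} :=
  measure_function_pushforward__canonical__measure_function_Measure m mf.

(** * Scaling of Lebesgue measure *)

Section scaling.
Local Open Scope ereal_scope.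
Context {R : realType}.

(* The pushforward of m under s is a^-1 m, expressed on integrals. *)
Definition scales d (T : measurableType d) (m : set T -> \bar R) (s : T -> T)
    (a : R) :=
  measurable_fun setT s /\
  forall f : T -> \bar R, measurable_fun setT f -> (forall x, 0 <= f x) ->
    \int[m]_x f x = a%:E * \int[m]_x f (s x).

Lemma scales_prod d1 d2 (T1 : measurableType d1) (T2 : measurableType d2)
    (m1 : {sigma_finite_measure set T1 -> \bar R})
    (m2 : {sigma_finite_measure set T2 -> \bar R}) s1 s2 (a b : R) :
  (0 <= b)%R -> scales m1 s1 a -> scales m2 s2 b ->
  scales (prod_measure m1 m2) (fun p => (s1 p.1, s2 p.2)) (a * b)%R.
Proof.
move=> b0 [ms1 H1] [ms2 H2].
have ms : measurable_fun setT (fun p : T1 * T2 => (s1 p.1, s2 p.2)).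
  apply: measurable_fun_pair; exact: measurableT_comp.
split=> // f mf f0.
rewrite [LHS](fubini_tonelli1 (m1 := m1) (m2 := m2) f)//.
rewrite [in RHS](fubini_tonelli1 (m1 := m1) (m2 := m2)
  (fun p => f (s1 p.1, s2 p.2)))//; last exact: measurableT_comp.
rewrite H1 /fubini_F //=; last 2 first.
- exact: measurable_fun_fubini_tonelli_F.
- by move=> x; exact: integral_ge0.
rewrite EFinM -muleA; congr (_ * _).
rewrite -ge0_integralZl//.
- apply: eq_integral => x _; rewrite H2//.
  exact: measurable_fun_pair2.
- apply: (measurable_fun_fubini_tonelli_F (fun p => f (s1 p.1, s2 p.2))) => //.
  exact: measurableT_comp.
- by move=> x _; exact: integral_ge0.
Qed.

(** The pushforward under multiplication by [l], multiplied by [l], gives each half-open interval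
    its length, and this characterizes Lebesgue measure. *)
Lemma scales_leb1 (l : R) : (0 < l)%R -> scales (leb1 R) ( *%R l) l.
Proof.
move=> l0.
have ml : measurable_fun setT ( *%R l : measurableTypeR R -> measurableTypeR R).
  by apply: measurable_funM.
split=> // f mf f0.
pose mu := pushforward_measure (leb1 R) ml.
pose k : {nonneg R} := NngNum (ltW l0).
transitivity (\int[mscale k mu]_x f x).
  apply: eq_measure_integral => //= A mA _.
  apply: lebesgue_measure_unique => //= _ [[a b] _ <-].
  rewrite /mu /= /mscale /= /pushforward.
  have -> : *%R l @^-1` `]a, b]%classic = `](a / l)%R, (b / l)%R]%classic.
    apply/seteqP; split => x /=;
      by rewrite !in_itv/= ltr_pdivrMr// ler_pdivlMr// mulrC.
  rewrite /leb1 /= !lebesgue_measure_itv/= !lte_fin ltr_pM2r ?invr_gt0//.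
  case: ifP => _; rewrite ?mule0// -EFinB -EFinM; congr EFin.
  by rewrite -mulrBl mulrCA divff ?mulr1// gt_eqF.
by rewrite ge0_integral_mscale//= ge0_integral_pushforward.
Qed.

Lemma scales_leb4 (l : R) : (0 < l)%R ->
  scales (leb4 R)
    (fun y => (l * y.1.1.1, l * y.1.1.2, l * y.1.2, l * y.2)%R) (l ^+ 4).
Proof.
move=> l0; have l0' := ltW l0; have s1 := scales_leb1 l0.
have := scales_prod l0' (scales_prod l0' (scales_prod l0' s1 s1) s1) s1.
by rewrite -!mulrA -!expr2 -!exprS.
Qed.

End scaling.

Lemma prod_measure_fin_num d1 d2 (T1 : measurableType d1)
    (T2 : measurableType d2) (R : realType)
    (m1 : {sigma_finite_measure set T1 -> \bar R})
    (m2 : {sigma_finite_measure set T2 -> \bar R}) (A : set T1) (B : set T2) :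
  measurable A -> measurable B -> m1 A \is a fin_num -> m2 B \is a fin_num ->
  prod_measure m1 m2 (A `*` B) \is a fin_num.
Proof.
move=> mA mB fA fB.
by rewrite [prod_measure _ _ _]product_measure1E// fin_numM.
Qed.

Section polar.
Context {R : realType}.
Local Notation M := (measurableTypeR R).

Lemma measurable_fun_dot4 d (T : measurableType d) (u v : T -> R4 M) :
  measurable_fun setT u -> measurable_fun setT v ->
  measurable_fun setT ((fun t => dot4 (u t) (v t)) : T -> M).
Proof.
move=> /measurable_fun_pairP[/measurable_fun_pairP[/measurable_fun_pairP[u1 u2]
  u3] u4] /measurable_fun_pairP[/measurable_fun_pairP[/measurable_fun_pairP[v1
  v2] v3] v4].
by rewrite /dot4; repeat apply: measurable_funD; exact: measurable_funM.
Qed.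

Lemma measurable_norm4 : measurable_fun setT (@norm4 R : R4 M -> M).
Proof.
apply: (@measurableT_comp _ _ _ _ _ _ (Num.sqrt : M -> M)).
  exact: (continuous_measurable_fun (@sqrt_continuous R)).
exact: measurable_fun_dot4.
Qed.

Lemma norm4_ge0 (y : R4 R) : 0 <= norm4 y.
Proof. exact: sqrtr_ge0. Qed.

Lemma norm4_scale (l : R) (y : R4 R) : 0 <= l ->
  norm4 (l * y.1.1.1, l * y.1.1.2, l * y.1.2, l * y.2) = l * norm4 y.
Proof.
move=> l0; rewrite /norm4 /dot4 /=.
have -> : l * y.1.1.1 * (l * y.1.1.1) + l * y.1.1.2 * (l * y.1.1.2) +
    l * y.1.2 * (l * y.1.2) + l * y.2 * (l * y.2) = l ^+ 2 * dot4 y y.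
  by rewrite /dot4; ring.
by rewrite sqrtrM ?sqr_ge0// sqrtr_sqr ger0_norm.
Qed.

Definition ball4_volume : \bar R := leb4 R [set y | norm4 y < 1].

Lemma measurable_ball4 (r : R) :
  measurable ([set y | norm4 y < r] : set (R4 M)).
Proof.
have := measurable_norm4 measurableT (measurable_itv `]-oo, r[).
by rewrite setTI; congr measurable; apply/seteqP; split=> y /=; rewrite in_itv.
Qed.

(** The ball lies in the cube of side ]-1, 1[. *)
Lemma ball4_volume_fin_num : ball4_volume \is a fin_num.
Proof.
rewrite ge0_fin_numE; last exact: measure_ge0.
pose I : set M := `]-1, 1[%classic.
have mI : measurable I by exact: measurable_itv.
apply: (@le_lt_trans _ _ (leb4 R (I `*` I `*` I `*` I))).
  apply: le_measure; rewrite ?inE; first exact: measurable_ball4.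
    by repeat apply: measurableX.
  move=> -[[[y1 y2] y3] y4]; rewrite /norm4 /dot4/= => y_lt1.
  have : y1 * y1 + y2 * y2 + y3 * y3 + y4 * y4 < 1.
    rewrite -ltr_sqrt// sqrtr1//.
  move=> {}y_lt1; rewrite /I/= !in_itv/=.
  by do ![split]; nra.
have lebI : (leb1 R I < +oo)%E.
  by rewrite [leb1 R _]lebesgue_measure_itv/= lte_fin; case: ifP; rewrite ?ltry.
have fI : leb1 R I \is a fin_num by rewrite ge0_fin_numE.
have mII : measurable (I `*` I) by exact: measurableX.
have mIII : measurable (I `*` I `*` I) by exact: measurableX.
rewrite -ge0_fin_numE//.
by do 3! [apply: prod_measure_fin_num => //].
Qed.

(** This is the scaling formula with factor [r], applied to the indicator of the ball of radius
    [r]. *)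
Lemma leb4_ball4 (r : R) : 0 < r ->
  leb4 R [set y | norm4 y < r] = ((r ^+ 4)%:E * ball4_volume)%E.
Proof.
move=> r0; have [_ H] := scales_leb4 r0.
have := H (fun y => (\1_[set y : R4 M | norm4 y < r] y)%:E) _ _.
rewrite integral_indic ?setIT//; last exact: measurable_ball4.
move=> ->.
- congr (_ * _)%E; rewrite /ball4_volume -[X in leb4 R X]setIT.
  rewrite -integral_indic//; last exact: measurable_ball4.
  apply: eq_integral => y _; rewrite !indicE; congr ((nat_of_bool _)%:R%:E).
  by apply/idP/idP; rewrite !inE/= norm4_scale ?ltW// gtr_pMr.
- apply/measurable_EFinP; apply: measurable_indic; exact: measurable_ball4.
- by move=> y; rewrite lee_fin.
Qed.

End polar.

(** * Distribution of the radius *)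

Section polar_coordinates.
Context {R : realType}.
Local Notation M := (measurableTypeR R).

(* The density of the radius: the area 4 c r^3 of the sphere of radius r, with
   c the volume of the unit ball. *)
Definition radial_density (r : R) : R :=
  4 * fine (@ball4_volume R) * (Num.max r 0) ^+ 3.

Lemma radial_density_ge0 (r : R) : 0 <= radial_density r.
Proof.
rewrite /radial_density mulr_ge0//.
  by rewrite mulr_ge0// fine_ge0//; exact: measure_ge0.
by rewrite exprn_ge0// le_max lexx orbT.
Qed.

Lemma measurable_radial_density :
  measurable_fun setT (radial_density : M -> R).
Proof.
by apply: measurable_funM => //; apply: measurable_funX; exact: measurable_maxr.
Qed.

(** For nonnegative radii the density is the derivative of [c * r ^+ 4], so that the ray []-oo, x[]
    receives the volume of the ball of radius [x]. *)
Lemma integral_radial_density (x : R) : 0 < x ->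
  (\int[leb1 R]_(r in `]-oo, x[) (radial_density r)%:E =
   (x ^+ 4)%:E * @ball4_volume R)%E.
Proof.
move=> x0; set c := fine (@ball4_volume R).
transitivity (\int[leb1 R]_(r in `[0%R, x[) (radial_density r)%:E)%E.
  (* Negative radii carry no mass: there [Num.max r 0] is 0. *)
  rewrite [LHS]integral_mkcond [RHS]integral_mkcond.
  apply: eq_integral => r _; rewrite !patchE !mem_setE !in_itv/=.
  case: (leP 0 r) => //= r0; case: ifP => // _.
  by rewrite /radial_density max_r ?ltW// expr0n mulr0.
rewrite integral_itv_bndo_bndc; last first.
  apply/measurable_EFinP; apply: measurable_funTS.
  exact: measurable_radial_density.
rewrite -(fineK ball4_volume_fin_num) -/c -EFinM.
have -> : ((x ^+ 4 * c)%:E = (c * x ^+ 4)%:E - (c * 0 ^+ 4)%:E)%E.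
  by rewrite expr0n mulr0 sube0 mulrC.
have dF (r : R) : derivable (fun r : R => c * r ^+ 4) r 1.
  exact: (derivableZ (k := c) (@exprn_derivable R 4 r 1)).
have cF : continuous (fun r : R => c * r ^+ 4).
  by move=> r; apply/differentiable_continuous/derivable1_diffP/dF.
apply: (@continuous_FTC2 _ radial_density (fun r : R => c * r ^+ 4)) => //.
- apply: continuous_subspaceT => r.
  apply: cvgM; first exact: cvg_cst.
  apply: (@continuous_comp _ _ _ (fun r : R => Num.max r 0)
    (fun r : R => r ^+ 3)).
    by apply: continuous_max => //; exact: cst_continuous.
  exact: exprn_continuous.
- split; first by move=> r _; exact: dF.
    by apply/cvg_at_right_filter; exact: cF.
  by apply/cvg_at_left_filter; exact: cF.
- move=> r; rewrite in_itv/= => /andP[r0 _].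
  rewrite derive1Ml ?exp_derive1; last exact: exprn_derivable.
  by rewrite /radial_density -/c max_l ?ltW// /GRing.scale/= mulrA (mulrC c).
Qed.

(** The image of Lebesgue measure under [norm4] and the measure of density [radial_density] agree on
    the rays []-oo, x[]. These are stable under intersection, generate the Borel sets and exhaust
    the line with finite measure, so the two measures are equal. *)
Lemma ge0_integral_norm4 (h : M -> \bar R) : measurable_fun setT h ->
  (forall r, 0 <= h r)%E ->
  (\int[leb4 R]_y h (norm4 y) = \int[leb1 R]_r (h r * (radial_density r)%:E))%E.
Proof.
move=> mh h0; have mn := @measurable_norm4 R.
have mw := measurable_radial_density; have w0 := radial_density_ge0.
rewrite -(@ge0_integral_density_measure _ _ _ (leb1 R) _ mw w0)//.
transitivity (\int[pushforward_measure (leb4 R) mn]_r h r)%E.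
  by rewrite ge0_integral_pushforward//.
apply: eq_measure_integral => A mA _.
have E x : pushforward_measure (leb4 R) mn `]-oo, x[%classic =
    leb4 R [set y | norm4 y < x].
  by rewrite /= /pushforward; congr (leb4 R _); apply/seteqP; split=> y /=;
    rewrite in_itv.
apply: (@measure_unique _ R M (@RGenInftyO.G R : set (set M))
  (fun k => `]-oo, k.+1%:R[%classic)) => //.
- exact: RGenInftyO.measurableE.
- move=> _ _ [x ->] [y ->]; exists (Num.min x y).
  by apply/seteqP; split=> r /=; rewrite !in_itv/= lt_min;
    [case=> -> ->|move/andP].
- by move=> k; exists k.+1%:R.
- apply/seteqP; split => // r _.
  exists (Num.truncn `|r|) => //=; rewrite in_itv/=.
  by rewrite (le_lt_trans (ler_norm r))// truncnS_gt.
- move=> _ [x ->].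
  have [x0|x0] := ltP 0 x.
    by rewrite E leb4_ball4//; exact/esym/integral_radial_density.
  (* For [x <= 0] the ball is empty and the density vanishes on the ray. *)
  rewrite E (_ : [set y | _] = set0) ?measure0; last first.
    apply/seteqP; split => // y /=; rewrite ltNge.
    by rewrite (le_trans x0 (norm4_ge0 y)).
  rewrite /= /density_fun; apply/esym/integral0_eq => r /=.
  rewrite in_itv/= => rx.
  rewrite /radial_density max_r ?expr0n ?mulr0//.
  by rewrite (le_trans (ltW rx)).
- move=> k; rewrite E leb4_ball4// -ge0_fin_numE ?mule_ge0//.
  by rewrite fin_numM// ball4_volume_fin_num.
Qed.

End polar_coordinates.

(** * Integrability of (1 + |xi|^2)^(-p) *)

Section japanese_bracket.
Context {R : realType}.
Local Notation M := (measurableTypeR R).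

Lemma powRN_cvgy0 (s : R) : 0 < s -> (1 + x) `^ (- s) @[x --> +oo] --> (0 : R).
Proof.
move=> s0; apply/cvgrPdist_le => e e0; near=> x.
rewrite sub0r normrN ger0_norm ?powR_ge0// powRN.
(* This threshold for 1 + x solves (1 + x)^(-s) = e. *)
have y0 : 0 < e^-1 `^ s^-1 by rewrite powR_gt0 ?invr_gt0.
have yx : e^-1 `^ s^-1 <= 1 + x.
  by rewrite -lerBlDl; near: x; apply: nbhs_pinfty_ge; rewrite num_real.
rewrite -[leRHS]invrK lef_pV2 ?posrE ?invr_gt0 ?powR_gt0//; last first.
  exact: lt_le_trans yx.
have -> : e^-1 = (e^-1 `^ s^-1) `^ s.
  by rewrite -powRrM mulVf ?gt_eqF// powRr1// invr_ge0 ltW.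
by rewrite ge0_ler_powR ?nnegrE ?(ltW s0) ?(ltW y0)// (le_trans (ltW y0)).
Unshelve. all: by end_near. Qed.

Lemma integral_powRN (s : R) : 0 < s ->
  (\int[leb1 R]_(x in `[0%R, +oo[) ((1 + x) `^ (- (s + 1)))%:E = (s^-1)%:E)%E.
Proof.
move=> s0.
have dp (a x : R) : 0 <= x ->
    is_derive x 1 (fun x : R => (1 + x) `^ a) (a * (1 + x) `^ (a - 1)).
  move=> x0.
  have d1 : is_derive (1 + x) 1 (fun x : R => x `^ a) (a * (1 + x) `^ (a - 1)).
    by apply: is_derive1_powR; rewrite ltr_wpDr.
  have d2 : is_derive x (1 : R) (fun x : R => 1 + x) 1.
    by rewrite -[X in is_derive _ _ _ X]add0r; exact: is_deriveD.
  by have := is_derive1_comp d1 d2; rewrite mulr1.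
have cp (a x : R) : 0 <= x -> {for x, continuous (fun x : R => (1 + x) `^ a)}.
  move=> x0; apply/differentiable_continuous/derivable1_diffP.
  by have [] := dp a x x0.
pose F x : R := - s^-1 * (1 + x) `^ (- s).
have -> : ((s^-1)%:E = 0%:E - (F 0)%:E :> \bar R)%E.
  by rewrite /F addr0 powR1 mulr1 -EFinB sub0r opprK.
have dF (x : R) : 0 <= x -> is_derive x 1 F ((1 + x) `^ (- (s + 1))).
  move=> x0; have H := dp (- s) x x0.
  have := is_deriveZ (- s^-1) H; congr is_derive.
  rewrite /GRing.scale/= -opprD mulrA mulNr mulrN opprK mulVf ?mul1r//.
  by rewrite gt_eqF.
apply: (@ge0_continuous_FTC2y _ _ F).
- by move=> x _; exact: powR_ge0.
- apply/continuous_within_itvcyP; split.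
    by move=> x; rewrite in_itv/= andbT => x0; exact/cp/ltW.
  by apply: cvg_at_right_filter; exact: cp.
- rewrite -(mulr0 (- s^-1)); apply: cvgM; first exact: cvg_cst.
  exact: powRN_cvgy0.
- by move=> x x0; have [] := dF x (ltW x0).
- apply: cvg_at_right_filter; apply: cvgM; first exact: cvg_cst.
  exact: cp.
- move=> x; rewrite in_itv/= andbT => x0; rewrite derive1E.
  by have [] := dF x (ltW x0).
Qed.

(** The weight in one variable; a product of five of them will dominate the weight on R^5. *)
Definition bracket (q x : R) : R := (1 + x ^+ 2) `^ (- q).

Lemma bracket_ge0 (q x : R) : 0 <= bracket q x.
Proof. exact: powR_ge0. Qed.

Lemma measurable_bracket (q : R) : measurable_fun setT (bracket q : M -> R).
Proof.
apply: (@measurableT_comp _ _ _ _ _ _ (fun x : R => x `^ (- q))).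
  exact: measurable_powR.
by apply: measurable_funD => //; exact: measurable_funX.
Qed.

Lemma continuous_bracket (q : R) : continuous (bracket q).
Proof.
move=> x; apply: (@continuous_comp _ _ _ (fun x : R => 1 + x ^+ 2)
    (fun x : R => x `^ (- q))).
  by apply: cvgD; [exact: cvg_cst|exact: exprn_continuous].
apply/differentiable_continuous/derivable1_diffP.
have H : 0 < 1 + x ^+ 2 by rewrite ltr_wpDr ?sqr_ge0.
by have [] := is_derive1_powR (- q) H.
Qed.

(** By evenness the half-line suffices. There (1 + x)^2 <= 2 (1 + x^2) bounds the weight by 2^q (1 +
    x)^(-2q), and 2q > 1. *)
Lemma integral_bracket_lty (q : R) : 2^-1 < q ->
  (\int[leb1 R]_x (bracket q x)%:E < +oo)%E.
Proof.
move=> q2; have q0 : 0 < q by lra.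
have mb := @measurable_bracket q.
(* The exponent -2q is written to match [integral_powRN] with [s := 2 * q - 1]. *)
have mp : measurable_fun setT
    (fun x : M => (1 + x) `^ (- (2 * q - 1 + 1)) : R).
  apply: (@measurableT_comp _ _ _ _ _ _
    (fun x : R => x `^ (- (2 * q - 1 + 1)))); first exact: measurable_powR.
  exact: measurable_funD.
rewrite (@ge0_symfun_integralT _ (bracket q)); last 3 first.
- exact: bracket_ge0.
- exact: continuous_bracket.
- by move=> x; rewrite /bracket /= sqrrN.
apply: lte_mul_pinfty => //.
rewrite -set_itvcy.
apply: (@le_lt_trans _ _ (\int[leb1 R]_(x in `[0%R, +oo[)
   ((2 `^ q)%:E * ((1 + x) `^ (- (2 * q - 1 + 1)))%:E))%E).
  apply: ge0_le_integral => //.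
  - by move=> x _; rewrite lee_fin bracket_ge0.
  - by apply/measurable_EFinP; apply: measurable_funTS;
      exact: measurable_bracket.
  - apply: measurable_funTS; apply: emeasurable_funM => //.
    exact/measurable_EFinP.
  - move=> x /=; rewrite in_itv/= andbT => x0; rewrite -EFinM lee_fin.
    have x1 : 0 < 1 + x by rewrite ltr_wpDr.
    have x2 : 0 < 1 + x ^+ 2 by rewrite ltr_wpDr ?sqr_ge0.
    rewrite /bracket subrK !powRN ler_pdivlMr ?powR_gt0//.
    rewrite ler_pdivrMl ?powR_gt0// powRrM powR_mulrn ?(ltW x1)//.
    rewrite -powRM ?(ltW x2)// ge0_ler_powR ?nnegrE ?(ltW q0)//.
    + exact: sqr_ge0.
    + by rewrite mulr_ge0 ?(ltW x2).
    + by rewrite -subr_ge0 (_ : _ - _ = (1 - x) ^+ 2 :> R) ?sqr_ge0//; ring.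
rewrite ge0_integralZl//; last 2 first.
- exact/measurable_EFinP/measurable_funTS.
- by move=> x _; rewrite lee_fin powR_ge0.
by rewrite integral_powRN -?EFinM ?ltry//; lra.
Qed.

End japanese_bracket.

Lemma prod_integral_lty d1 d2 (T1 : measurableType d1) (T2 : measurableType d2)
    (R : realType) (m1 : {sigma_finite_measure set T1 -> \bar R})
    (m2 : {sigma_finite_measure set T2 -> \bar R})
    (f1 : T1 -> R) (f2 : T2 -> R) :
  measurable_fun setT f1 -> measurable_fun setT f2 ->
  (forall x, 0 <= f1 x) -> (forall x, 0 <= f2 x) ->
  (\int[m1]_x (f1 x)%:E < +oo)%E -> (\int[m2]_x (f2 x)%:E < +oo)%E ->
  (\int[prod_measure m1 m2]_p (f1 p.1 * f2 p.2)%:E < +oo)%E.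
Proof.
move=> mf1 mf2 f10 f20 if1 if2.
rewrite [ltLHS](fubini_tonelli1 (m1 := m1) (m2 := m2)
  (fun p => (f1 p.1 * f2 p.2)%:E)); last 2 first.
- by apply/measurable_EFinP; apply: measurable_funM; exact: measurableT_comp.
- by move=> p; rewrite lee_fin mulr_ge0.
have i20 : (0 <= \int[m2]_y (f2 y)%:E)%E.
  by apply: integral_ge0 => y _; rewrite lee_fin.
have -> : (\int[m1]_x fubini_F m2 (fun p => (f1 p.1 * f2 p.2)%:E) x =
    \int[m1]_x ((f1 x)%:E * \int[m2]_y (f2 y)%:E))%E.
  apply: eq_integral => x _; rewrite /fubini_F /=.
  under eq_integral do rewrite EFinM.
  by rewrite ge0_integralZl// ?lee_fin//;
    [exact/measurable_EFinP|move=> y _; rewrite lee_fin].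
rewrite ge0_integralZr//; last 2 first.
- exact/measurable_EFinP.
- by move=> x _; rewrite lee_fin.
have i10 : (0 <= \int[m1]_y (f1 y)%:E)%E.
  by apply: integral_ge0 => y _; rewrite lee_fin.
by rewrite lte_mul_pinfty// ge0_fin_numE.
Qed.

Lemma ge0_ler_powRN (R : realType) (q a b : R) : 0 <= q -> 0 < a -> a <= b ->
  b `^ (- q) <= a `^ (- q).
Proof.
move=> q0 a0 ab; have b0 := lt_le_trans a0 ab.
rewrite !powRN lef_pV2 ?posrE ?powR_gt0// ge0_ler_powR ?nnegrE//; exact: ltW.
Qed.

Section bracket5.
Context {R : realType}.
Local Notation M := (measurableTypeR R).

Lemma measurable_fun_dot5 d (T : measurableType d) (u v : T -> R5 M) :
  measurable_fun setT u -> measurable_fun setT v ->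
  measurable_fun setT ((fun t => dot5 (u t) (v t)) : T -> M).
Proof.
move=> /measurable_fun_pairP[u1 u2] /measurable_fun_pairP[v1 v2].
by apply: measurable_funD; [exact: measurable_fun_dot4|exact: measurable_funM].
Qed.

Lemma dot5_ge0 (x : R5 R) : 0 <= dot5 x x.
Proof. by rewrite /dot5 /dot4 !addr_ge0// -expr2 sqr_ge0. Qed.

Lemma measurable_bracket5 (q : R) :
  measurable_fun setT ((fun x => (1 + dot5 x x) `^ q) : R5 M -> M).
Proof.
apply: (@measurableT_comp _ _ _ _ _ _ (fun x : R => x `^ q)).
  exact: measurable_powR.
by apply: measurable_funD => //; exact: measurable_fun_dot5.
Qed.

(** Write the weight as the fifth power of (1 + |x|^2)^(-p/5) and bound each of the five factors by
    the weight of one coordinate. Tonelli then reduces to one variable, where p/5 > 1/2 is exactly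
    what convergence requires. *)
Lemma integral_bracket5_lty (p : R) : 5 / 2 < p ->
  (\int[leb5 R]_x ((1 + dot5 x x) `^ (- p))%:E < +oo)%E.
Proof.
move=> p52; pose q := p / 5.
have q2 : 2^-1 < q by rewrite /q; lra.
have q0 : 0 <= q by lra.
pose b := @bracket R q; have b0 := @bracket_ge0 R q.
have mb : measurable_fun setT (b : M -> R) := @measurable_bracket R q.
have ib := integral_bracket_lty q2.
pose b2 (x : M * M) := b x.1 * b x.2.
pose b3 (x : R3 M) := b2 x.1 * b x.2.
pose b4 (x : R4 M) := b3 x.1 * b x.2.
have b20 x : 0 <= b2 x by rewrite mulr_ge0.
have b30 x : 0 <= b3 x by rewrite mulr_ge0.
have b40 x : 0 <= b4 x by rewrite mulr_ge0.
have mb2 : measurable_fun setT b2.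
  by apply: measurable_funM; exact: measurableT_comp.
have mb3 : measurable_fun setT b3.
  by apply: measurable_funM; exact: measurableT_comp.
have mb4 : measurable_fun setT b4.
  by apply: measurable_funM; exact: measurableT_comp.
have i2 := prod_integral_lty mb mb b0 b0 ib ib.
have i3 := prod_integral_lty mb2 mb b20 b0 i2 ib.
have i4 := prod_integral_lty mb3 mb b30 b0 i3 ib.
have i5 : (\int[leb5 R]_x (b4 x.1 * b x.2)%:E < +oo)%E.
  exact: prod_integral_lty mb4 mb b40 b0 i4 ib.
apply: le_lt_trans i5.
apply: (@ge0_le_integral _ _ _ (leb5 R) _ measurableT).
- by move=> x _; rewrite lee_fin powR_ge0.
- by apply/measurable_EFinP; exact: measurable_bracket5.
- apply/measurable_EFinP.
  by apply: measurable_funM; exact: measurableT_comp.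
move=> [[[[x1 x2] x3] x4] x5] _; rewrite lee_fin.
rewrite /b4 /b3 /b2 /b /bracket /=.
set D := 1 + _.
have DE : D = 1 + x1 ^+ 2 + x2 ^+ 2 + x3 ^+ 2 + x4 ^+ 2 + x5 ^+ 2.
  by rewrite /D /dot5 /dot4 /= !expr2 !addrA.
have D0 : 0 <= D by rewrite DE !addr_ge0 ?sqr_ge0.
have -> : - p = - q * 5%:R by rewrite /q; field.
rewrite powRrM powR_mulrn ?powR_ge0//.
have H (x : R) : 1 + x ^+ 2 <= D -> D `^ (- q) <= (1 + x ^+ 2) `^ (- q).
  by move=> xD; apply: ge0_ler_powRN => //; rewrite ltr_wpDr ?sqr_ge0.
have := (sqr_ge0 (x1 : R), sqr_ge0 (x2 : R), sqr_ge0 (x3 : R),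
  sqr_ge0 (x4 : R), sqr_ge0 (x5 : R)).
move=> [[[[y1 y2] y3] y4] y5].
rewrite !(exprS (D `^ _)) expr0 mulr1 !mulrA.
by repeat apply: ler_pM; rewrite ?mulr_ge0 ?powR_ge0//; apply: H;
  rewrite DE; lra.
Qed.

End bracket5.

(** * Cutoffs and their Fourier kernels *)

(** The difference quotients of [f] at [x] along [v] are those at 0 of its restriction to the line
    through [x]; calculus in one variable then applies. *)
Lemma is_derive_line (R : numFieldType) (V W : normedModType R) (f : V -> W)
    (x v : V) (df : W) :
  is_derive (0 : R) 1 (fun h : R => f (h *: v + x)) df -> is_derive x v f df.
Proof.
move=> [d0 <-]; apply: DeriveDef; first exact/derivable1P.
rewrite /derive; set g1 := fun h => h^-1 *: _; set g2 := fun h => h^-1 *: _.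
suff -> : g1 = g2 by []; apply/funext => h; rewrite /g1 /g2 /=.
by rewrite addr0 scale0r add0r [_%:A]mulr1.
Qed.

Section cutoff_facts.
Context {R : realType}.
Local Notation M := (measurableTypeR R).
Local Notation e5 := ((0, 1) : R5 R).

Lemma dot5_line (xi x : R5 R) (h : R) :
  dot5 xi (h *: e5 + x) = h * xi.2 + dot5 xi x.
Proof.
rewrite /dot5 /dot4 /= /GRing.scale /= /GRing.scale/=.
by rewrite !mulr0 !add0r; ring.
Qed.

(** The factor [xi.2] produced here is the only source of growth in [xi], and costs one power of
    |xi| in the final estimate. *)
Lemma is_derive_dot5 (xi x : R5 R) (f : R -> R) (df : R) :
  is_derive (dot5 xi x) 1 f df ->
  is_derive x e5 (fun x => f (dot5 xi x)) (df * xi.2).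
Proof.
move=> dfx; apply: is_derive_line.
have -> : (fun h : R => f (dot5 xi (h *: e5 + x))) =
    f \o (fun h => h * xi.2 + dot5 xi x).
  by apply/funext => h /=; rewrite dot5_line.
apply: is_derive1_comp; first by rewrite mul0r add0r.
have := is_deriveD (is_deriveM (is_derive_id (0 : R) 1)
  (is_derive_cst (xi.2) (0 : R) 1)) (is_derive_cst (dot5 xi x) (0 : R) 1).
by congr is_derive; rewrite scaler0 add0r addr0 [LHS]mulr1.
Qed.

Section fixed_cutoff.
Variables (chi : R5 R -> R) (hchi : cutoff chi).

Let dzchi := 'D_e5 chi.

Lemma cutoff_differentiable x : differentiable chi x.
Proof. by have [/(_ [::])] := hchi. Qed.

Lemma cutoff_dz_differentiable x : differentiable dzchi x.
Proof. by have [/(_ [:: e5])] := hchi. Qed.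

Lemma cutoff_continuous : continuous chi.
Proof. by move=> x; exact/differentiable_continuous/cutoff_differentiable. Qed.

Lemma cutoff_dz_continuous : continuous dzchi.
Proof.
by move=> x; exact/differentiable_continuous/cutoff_dz_differentiable.
Qed.

Lemma derive_cutoff_mul (phi : R5 R -> R) x dphi : is_derive x e5 phi dphi ->
  'D_e5 (fun x => chi x * phi x) x = chi x * dphi + phi x * dzchi x.
Proof.
move=> [dphix <-].
have := @deriveM R (R5 R) chi phi x e5 _ dphix; apply.
exact/diff_derivable/cutoff_differentiable.
Qed.

Lemma cutoff_out x : ~ tsupp chi x -> chi x = 0.
Proof.
move=> nx; apply: contrapT => /eqP chix; apply: nx.
exact: subset_closure.
Qed.

(** The complement of the support is open, so [chi] vanishes near [x]. *)
Lemma cutoff_dz_out x : ~ tsupp chi x -> dzchi x = 0.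
Proof.
move=> nx.
have : \forall y \near x, chi y = (cst 0 : R5 R -> R) y.
  have : open (~` tsupp chi) by apply: closed_openC; exact: closed_closure.
  rewrite openE => /(_ x nx); apply: filterS => y; exact: cutoff_out.
move=> H; rewrite /dzchi (near_eq_derive _ H) ?derive_cst//.
Qed.

Lemma continuous_norm4 : continuous (fun x : R5 R => norm4 x.1).
Proof.
have cfst (U V W : topologicalType) (f : U -> V * W) :
    continuous f -> continuous (fun u => (f u).1).
  by move=> cf u; apply: continuous_comp; [exact: cf|exact: cvg_fst].
have csnd (U V W : topologicalType) (f : U -> V * W) :
    continuous f -> continuous (fun u => (f u).2).
  by move=> cf u; apply: continuous_comp; [exact: cf|exact: cvg_snd].
have csqr (f : R5 R -> R) : continuous f -> continuous (fun x => f x * f x).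
  by move=> cf x; apply: cvgM; exact: cf.
have cadd (f g : R5 R -> R) : continuous f -> continuous g ->
    continuous (fun x => f x + g x).
  by move=> cf cg x; apply: cvgD; [exact: cf|exact: cg].
have c1 : continuous (fun x : R5 R => x.1) by apply: cfst => x; exact: cvg_id.
have c2 := cfst _ _ _ _ c1; have c3 := cfst _ _ _ _ c2.
move=> x.
apply: (@continuous_comp _ _ _ (fun x : R5 R => dot4 x.1 x.1) Num.sqrt);
  last exact: sqrt_continuous.
exact: (cadd _ _ (cadd _ _ (cadd _ _ (csqr _ (cfst _ _ _ _ c3))
  (csqr _ (csnd _ _ _ _ c3))) (csqr _ (csnd _ _ _ _ c2)))
  (csqr _ (csnd _ _ _ _ c1))).
Qed.

(** Both functions are continuous and vanish off the compact support, where the extreme value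
    theorem applies. *)
Lemma cutoff_bounded : exists C : R, [/\ 0 <= C,
  (forall x, `|chi x| <= C) & (forall x, `|dzchi x| <= C)].
Proof.
have [_ ct _] := hchi.
have bound (f : R5 R -> R) : continuous f ->
    (forall x, ~ tsupp chi x -> f x = 0) ->
    exists2 C : R, 0 <= C & forall x, `|f x| <= C.
  move=> cf f0.
  have [[x0 tx0]|t0] := pselect (tsupp chi !=set0); last first.
    exists 0 => // x; rewrite f0 ?normr0// => tx; apply: t0; by exists x.
  have [|c _ cmax] := @compact_EVT_max _ R (fun x => `|f x|) _
      (ex_intro _ x0 tx0) ct.
    apply: continuous_subspaceT => x; apply: continuous_comp; first exact: cf.
    exact: norm_continuous.
  exists `|f c| => // x; have [tx|tx] := pselect (tsupp chi x).
    by apply: cmax; rewrite inE.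
  by rewrite f0// normr0.
have [C1 C10 H1] := bound _ cutoff_continuous cutoff_out.
have [C2 C20 H2] := bound _ cutoff_dz_continuous cutoff_dz_out.
exists (Num.max C1 C2); split; first by rewrite le_max C10.
- by move=> x; rewrite le_max H1.
- by move=> x; rewrite le_max H2 orbT.
Qed.

(** The maxima of |y| and |z| over the compact support are attained at points of the open cylinder,
    hence are below 1. *)
Lemma cutoff_tsupp_subcylinder : exists rho w : R,
  [/\ 0 < rho < 1, 0 <= w < 1 &
      forall x, tsupp chi x -> norm4 x.1 <= rho /\ `|x.2| <= w].
Proof.
have [_ ct tc] := hchi.
have [[x0 tx0]|t0] := pselect (tsupp chi !=set0); last first.
  exists 2^-1, 0; split; [lra|lra|move=> x tx; exfalso; apply: t0; by exists x].
have [|c cin cmax] := @compact_EVT_max _ R (fun x => norm4 x.1) _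
      (ex_intro _ x0 tx0) ct.
  exact/continuous_subspaceT/continuous_norm4.
have [|d din dmax] := @compact_EVT_max _ R (fun x => `|x.2|) _
      (ex_intro _ x0 tx0) ct.
  apply: continuous_subspaceT => x; apply: continuous_comp.
    exact: cvg_snd.
  exact: norm_continuous.
rewrite inE in cin; rewrite inE in din.
have [c1 _] := tc _ cin; have [_ d1] := tc _ din.
(* The maximum with 1/2 keeps [rho] positive, as [L1loc_cvg0] demands, when the support lies on the
   axis. *)
exists (Num.max (norm4 c.1) 2^-1), `|d.2|; split.
- by rewrite lt_max gt_max c1 /=; apply/andP; split; [apply/orP; right|]; lra.
- by rewrite normr_ge0 /= ltr_norml.
- move=> x tx; split; last by apply: dmax; rewrite inE.
  by rewrite le_max cmax// inE.
Qed.

End fixed_cutoff.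
End cutoff_facts.

(** * Bounds on the lifted functions *)

(** Tonelli applies to the positive and negative parts separately; the difference is taken in the
    extended reals, so integrability is not assumed. *)
Lemma measurable_fun_integral d1 d2 (T1 : measurableType d1)
    (T2 : measurableType d2) (R : realType)
    (m2 : {sigma_finite_measure set T2 -> \bar R}) (f : T1 * T2 -> \bar R) :
  measurable_fun setT f ->
  measurable_fun setT (fun x => \int[m2]_y f (x, y))%E.
Proof.
move=> mf; under eq_fun do rewrite integralE.
apply: emeasurable_funB.
- rewrite (_ : (fun x => _) = fubini_F m2 f^\+%E).
    apply: measurable_fun_fubini_tonelli_F => //; exact: measurable_funepos.
  by apply/funext => x; apply: eq_integral => y _; rewrite !funeposE.
- rewrite (_ : (fun x => _) = fubini_F m2 f^\-%E).
    apply: measurable_fun_fubini_tonelli_F => //; exact: measurable_funeneg.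
  by apply/funext => x; apply: eq_integral => y _; rewrite !funenegE.
Qed.

Lemma le_abse_fine (R : realType) (x : \bar R) : (`|fine x|%:E <= `|x|)%E.
Proof. by case: x => [r| |] //=; rewrite normr0 leey. Qed.

Section kernel_bound.
Context {R : realType}.
Local Notation M := (measurableTypeR R).
Variables (G : R3 M -> R) (mG : measurable_fun setT G).

(** This is A(t), with [G] standing for f extended by zero from a compact subcylinder. *)
Definition lift_mass (t : M) : \bar R :=
  (\int[leb5 R]_x `|G (norm4 x.1, x.2, t)|%:E)%E.

Lemma measurable_lift d (T : measurableType d) (u : T -> R5 M) (v : T -> M) :
  measurable_fun setT u -> measurable_fun setT v ->
  measurable_fun setT (fun p => G (norm4 (u p).1, (u p).2, v p)).
Proof.
move=> /measurable_fun_pairP[u1 u2] mv; apply: (measurableT_comp mG).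
apply: measurable_fun_pair => //; apply: measurable_fun_pair => //.
apply: (measurableT_comp (@measurable_norm4 R) u1).
Qed.

Lemma measurable_lift_mass : measurable_fun setT lift_mass.
Proof.
apply: (@measurable_fun_integral _ _ M (R5 M) R (leb5 R)
  (fun p => `|G (norm4 p.2.1, p.2.2, p.1)|%:E)).
apply/measurable_EFinP; apply: measurableT_comp => //.
exact: measurable_lift.
Qed.

Lemma lift_mass_ge0 t : (0 <= lift_mass t)%E.
Proof. by apply: integral_ge0 => x _; rewrite lee_fin. Qed.

Section one_kernel.
Variables (Phi : R5 M -> R5 M -> R) (C : R).
Hypothesis mPhi :
  measurable_fun setT (fun p : R5 M * R5 M => Phi p.1 p.2).
Hypothesis bPhi : forall xi x, `|Phi xi x| <= C * (1 + `|xi.2|).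

(** [Phi xi] stands for the z-derivative of the cutoff times cos or sin of <xi, x>. *)
Definition lift_pairing (xi : R5 M) (t : M) : R :=
  fine (\int[leb5 R]_x (G (norm4 x.1, x.2, t) * Phi xi x)%:E)%E.

Lemma measurable_lift_pairing :
  measurable_fun setT (fun p : R5 M * M => lift_pairing p.1 p.2).
Proof.
apply: measurableT_comp => //.
apply: (@measurable_fun_integral _ _ (R5 M * M)%type (R5 M) R (leb5 R)
  (fun p => (G (norm4 p.2.1, p.2.2, p.1.2) * Phi p.1.1 p.2)%:E)).
apply/measurable_EFinP; apply: measurable_funM.
  by apply: measurable_lift => //; exact: measurableT_comp.
have mg : measurable_fun setT (fun p : R5 M * M * R5 M => (p.1.1, p.2)).
  by apply: measurable_fun_pair => //; exact: measurableT_comp.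
exact: (measurableT_comp mPhi mg).
Qed.

Lemma lift_pairing_le xi t :
  (`|lift_pairing xi t|%:E <= (C * (1 + `|xi.2|))%:E * lift_mass t)%E.
Proof.
have mL : measurable_fun setT (fun x : R5 M => G (norm4 x.1, x.2, t)).
  exact: measurable_lift.
have mP : measurable_fun setT (Phi xi).
  exact: (measurable_fun_pair2 (f := fun p => Phi p.1 p.2)).
apply: le_trans (le_abse_fine _) _.
apply: le_trans (le_abse_integral _ _ _) _ => //.
  by apply/measurable_EFinP; exact: measurable_funM.
rewrite -ge0_integralZl//; last 2 first.
- by apply/measurable_EFinP; exact: measurableT_comp.
(* The bound at a single point shows that the constant is nonnegative. *)
- by rewrite lee_fin; apply: le_trans (bPhi xi (0, 0, 0, 0, 0)).
apply: (@ge0_le_integral _ _ _ (leb5 R) _ measurableT).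
- by [].
- by apply/measurable_EFinP; apply: measurableT_comp => //;
    exact: measurable_funM.
- apply: emeasurable_funM => //; apply/measurable_EFinP.
  exact: measurableT_comp.
- by move=> x _; rewrite -EFinM lee_fin normrM mulrC ler_wpM2r.
Qed.

End one_kernel.
End kernel_bound.

(** * The H^(-m) norm at a fixed time *)

Section norm_bound.
Context {R : realType}.
Local Notation M := (measurableTypeR R).
Variables (G : R3 M -> R) (mG : measurable_fun setT G).
Variables (Phi1 Phi2 : R5 M -> R5 M -> R) (C : R).
Hypothesis mPhi1 : measurable_fun setT (fun p : R5 M * R5 M => Phi1 p.1 p.2).
Hypothesis mPhi2 : measurable_fun setT (fun p : R5 M * R5 M => Phi2 p.1 p.2).
Hypothesis C0 : 0 <= C.
Hypothesis bPhi1 : forall xi x, `|Phi1 xi x| <= C * (1 + `|xi.2|).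
Hypothesis bPhi2 : forall xi x, `|Phi2 xi x| <= C * (1 + `|xi.2|).
Variables (m : R) (hm : 7 / 2 < m).

Definition lift_sqnorm (xi : R5 M) (t : M) : R :=
  (1 + dot5 xi xi) `^ (- m) *
    (lift_pairing G Phi1 xi t ^+ 2 + lift_pairing G Phi2 xi t ^+ 2).

Definition lift_norm (t : M) : \bar R :=
  ((\int[leb5 R]_xi (lift_sqnorm xi t)%:E) `^ 2^-1)%E.

Lemma lift_sqnorm_ge0 xi t : 0 <= lift_sqnorm xi t.
Proof. by rewrite mulr_ge0 ?powR_ge0// addr_ge0 ?sqr_ge0. Qed.

Lemma measurable_lift_sqnorm :
  measurable_fun setT (fun p : R5 M * M => lift_sqnorm p.1 p.2).
Proof.
apply: measurable_funM.
  exact: (measurableT_comp (@measurable_bracket5 R (- m)) measurable_fst).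
by apply: measurable_funD; apply: measurable_funX;
  exact: measurable_lift_pairing.
Qed.

Lemma measurable_lift_norm : measurable_fun setT lift_norm.
Proof.
apply: (measurableT_comp (measurable_poweR (2^-1 : R))).
apply: (@measurable_fun_fubini_tonelli_G _ _ (R5 M) M R (leb5 R)
  (fun p => (lift_sqnorm p.1 p.2)%:E)).
- by apply/measurable_EFinP; exact: measurable_lift_sqnorm.
- by move=> p; rewrite lee_fin lift_sqnorm_ge0.
Qed.

Definition bracket5_integral : R :=
  fine (\int[leb5 R]_x ((1 + dot5 x x) `^ (- (m - 1)))%:E)%E.

(** Each squared pairing is at most C^2 a^2 (1 + |xi.2|)^2 <= 2 C^2 a^2 (1 + |xi|^2). The two
    pairings give the constant 4, and the factor 1 + |xi|^2 turns the exponent -m into -(m - 1). *)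
Lemma lift_sqnorm_le (a : R) xi t : 0 <= a -> lift_mass G t = a%:E ->
  lift_sqnorm xi t <= 4 * C ^+ 2 * a ^+ 2 * (1 + dot5 xi xi) `^ (- (m - 1)).
Proof.
move=> a0 ta; set B := 1 + dot5 xi xi.
have B0 : 0 < B by rewrite ltr_wpDr ?dot5_ge0.
have xiB : (1 + `|xi.2|) ^+ 2 <= 2 * B.
  have H : xi.2 ^+ 2 <= dot5 xi xi.
    by rewrite /dot5 expr2 lerDr /dot4 !addr_ge0// -expr2 sqr_ge0.
  apply: (@le_trans _ _ (2 * (1 + `|xi.2| ^+ 2))).
    rewrite -subr_ge0 (_ : _ - _ = (1 - `|xi.2|) ^+ 2 :> R) ?sqr_ge0//.
    by ring.
  by rewrite ler_pM2l// /B lerD2l real_normK ?num_real.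
have pair (Phi : R5 M -> R5 M -> R) :
    measurable_fun setT (fun p : R5 M * R5 M => Phi p.1 p.2) ->
    (forall xi x, `|Phi xi x| <= C * (1 + `|xi.2|)) ->
    lift_pairing G Phi xi t ^+ 2 <= C ^+ 2 * a ^+ 2 * (2 * B).
  move=> mPhi bPhi; have := lift_pairing_le mG mPhi bPhi xi t.
  rewrite ta -EFinM lee_fin => H.
  rewrite -real_normK ?num_real//.
  apply: (@le_trans _ _ ((C * (1 + `|xi.2|) * a) ^+ 2)).
    by rewrite ler_pXn2r ?nnegrE ?mulr_ge0// addr_ge0.
  rewrite (_ : (C * _ * a) ^+ 2 = C ^+ 2 * a ^+ 2 * (1 + `|xi.2|) ^+ 2).
    by rewrite ler_wpM2l// mulr_ge0 ?sqr_ge0.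
  by ring.
have H := lerD (pair _ mPhi1 bPhi1) (pair _ mPhi2 bPhi2).
rewrite /lift_sqnorm -/B (_ : - (m - 1) = - m + 1); last by ring.
rewrite (@powRD _ B (- m) 1) ?(gt_eqF B0) ?implybT// powRr1 ?(ltW B0)//.
apply: le_trans (ler_wpM2l (powR_ge0 _ _) H) _.
by rewrite le_eqVlt; apply/orP; left; apply/eqP; ring.
Qed.

Lemma lift_norm_le t :
  (lift_norm t <=
   (Num.sqrt (4 * C ^+ 2 * bracket5_integral) + 1)%:E * lift_mass G t)%E.
Proof.
(* The added 1 makes [D] positive, so that the right-hand side is infinite when the mass is. *)
set D := _ + 1.
have D0 : 0 < D by rewrite ltr_wpDl// sqrtr_ge0.
have := lift_mass_ge0 G t; case ta : (lift_mass G t) => [a| |//].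
- rewrite lee_fin => a0.
  set J := bracket5_integral.
  have m52 : 5 / 2 < m - 1 by move: hm; lra.
  have iJ := integral_bracket5_lty m52.
  have JE : (\int[leb5 R]_x ((1 + dot5 x x) `^ (- (m - 1)))%:E)%E = J%:E.
    rewrite /J /bracket5_integral fineK// ge0_fin_numE; first exact: iJ.
    by apply: integral_ge0 => x _; rewrite lee_fin powR_ge0.
  have J0 : 0 <= J.
    by rewrite -lee_fin -JE; apply: integral_ge0 => x _;
      rewrite lee_fin powR_ge0.
  apply: (@le_trans _ _ (((4 * C ^+ 2 * a ^+ 2 * J)%:E) `^ 2^-1)%E).
    have ge0_itv (x : \bar R) : (0 <= x)%E -> x \in `[0%E, +oo%E].
      by move=> x0; rewrite in_itv/= x0 leey.
    apply: gt0_ler_poweR; first by rewrite invr_ge0.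
    + apply/ge0_itv/integral_ge0 => x _.
      by rewrite lee_fin lift_sqnorm_ge0.
    + by apply: ge0_itv; rewrite lee_fin !mulr_ge0 ?sqr_ge0.
    rewrite EFinM -JE -ge0_integralZl//; last 3 first.
    + by apply/measurable_EFinP; exact: measurable_bracket5.
    + by move=> x _; rewrite lee_fin powR_ge0.
    + by rewrite lee_fin !mulr_ge0 ?sqr_ge0.
    apply: (@ge0_le_integral _ _ _ (leb5 R) _ measurableT).
    + by move=> x _; rewrite lee_fin lift_sqnorm_ge0.
    + apply/measurable_EFinP.
      exact: (measurable_fun_pair1 (f := fun p => lift_sqnorm p.1 p.2))
        measurable_lift_sqnorm.
    + apply: emeasurable_funM => //.
      by apply/measurable_EFinP; exact: measurable_bracket5.
    + by move=> x _; rewrite -EFinM lee_fin lift_sqnorm_le.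
  rewrite poweR_EFin powR12_sqrt ?mulr_ge0 ?sqr_ge0// -EFinM lee_fin.
  rewrite (_ : 4 * _ * _ * J = 4 * C ^+ 2 * J * a ^+ 2); last by ring.
  rewrite sqrtrM ?mulr_ge0 ?sqr_ge0// sqrtr_sqr ger0_norm//.
  by rewrite ler_wpM2r// lerDl.
- by move=> _; rewrite gt0_muley// ?lte_fin// leey.
Qed.

End norm_bound.

(** * Time integral of the mass *)

Section mass_integral.
Context {R : realType}.
Local Notation M := (measurableTypeR R).
Variables (G : R3 M -> R) (mG : measurable_fun setT G).

(** Tonelli puts the z-integral outside, leaving for each z the integral over R^4 of a function of
    |y|. *)
Lemma lift_massE (t : M) :
  lift_mass G t = (\int[prod_measure (leb1 R) (leb1 R)]_p
    (`|G (p.1, p.2, t)| * radial_density p.1)%:E)%E.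
Proof.
have mGt : measurable_fun setT (fun p : M * M => G (p.1, p.2, t)).
  apply: (measurableT_comp mG).
  by apply: measurable_fun_pair => //; apply: measurable_fun_pair.
rewrite /lift_mass.
rewrite [LHS](fubini_tonelli2 (m1 := leb4 R) (m2 := leb1 R)
  (fun x => `|G (norm4 x.1, x.2, t)|%:E))//; last first.
  by apply/measurable_EFinP; apply: measurableT_comp => //;
    exact: measurable_lift.
rewrite [RHS](fubini_tonelli2 (m1 := leb1 R) (m2 := leb1 R)
  (fun p => (`|G (p.1, p.2, t)| * radial_density p.1)%:E))//; last 2 first.
- apply/measurable_EFinP; apply: measurable_funM.
    exact: measurableT_comp.
  exact: (measurableT_comp (@measurable_radial_density R) measurable_fst).
- by move=> p; rewrite lee_fin mulr_ge0// radial_density_ge0.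
apply: eq_integral => z _; rewrite /fubini_G /=.
rewrite (ge0_integral_norm4 (h := fun r : M => `|G (r, z, t)|%:E))//.
apply/measurable_EFinP; apply: measurableT_comp => //.
exact: (measurable_fun_pair1 (f := fun p : M * M => G (p.1, p.2, t))).
Qed.

Lemma integral_lift_mass :
  (\int[leb1 R]_t lift_mass G t =
   \int[leb3 R]_p (`|G p| * radial_density p.1.1)%:E)%E.
Proof.
rewrite [RHS](fubini_tonelli2 (m1 := prod_measure (leb1 R) (leb1 R))
  (m2 := leb1 R) (fun p => (`|G p| * radial_density p.1.1)%:E))//; last 2 first.
- apply/measurable_EFinP; apply: measurable_funM.
    exact: measurableT_comp.
  apply: (measurableT_comp (@measurable_radial_density R)).
  exact: measurableT_comp.
- by move=> p; rewrite lee_fin mulr_ge0// radial_density_ge0.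
apply: eq_integral => t _; rewrite lift_massE /fubini_G.
by apply: eq_integral => -[r z] _.
Qed.

End mass_integral.

(** * Kernels of the cutoff and conclusion *)

Section main.
Context {R : realType}.
Local Notation M := (measurableTypeR R).
Local Notation e5 := ((0, 1) : R5 R).

Definition test_kernel (chi : R5 R -> R) (f : R -> R) (xi x : R5 R) : R :=
  'D_e5 (fun y => chi y * f (dot5 xi y)) x.

Section test_kernel_facts.
Variables (chi : R5 R -> R) (hchi : cutoff chi) (f f' : R -> R).
Hypothesis df : forall u : R, is_derive u 1 f (f' u).

Lemma test_kernelE xi x : test_kernel chi f xi x =
  chi x * (f' (dot5 xi x) * xi.2) + f (dot5 xi x) * 'D_e5 chi x.
Proof.
by apply: derive_cutoff_mul => //; exact: is_derive_dot5.
Qed.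

Lemma test_kernel_out xi x : ~ tsupp chi x -> test_kernel chi f xi x = 0.
Proof.
move=> nx; rewrite test_kernelE (cutoff_out nx) (cutoff_dz_out nx).
by rewrite mul0r mulr0 addr0.
Qed.

(** Joint measurability is read off the product rule, whose ingredients are continuous functions of
    [x], of [xi.2] or of the inner product. *)
Lemma measurable_test_kernel : continuous f -> continuous f' ->
  measurable_fun setT (fun p : R5 M * R5 M => test_kernel chi f p.1 p.2).
Proof.
move=> cf cf'.
have mchi := continuous_measurable_R5 (cutoff_continuous hchi).
have mdz := continuous_measurable_R5 (cutoff_dz_continuous hchi).
have mf := continuous_measurable_fun cf.
have mf' := continuous_measurable_fun cf'.
have mdot : measurable_fun setT (fun p : R5 M * R5 M => dot5 p.1 p.2 : R).
  exact: (measurable_fun_dot5 measurable_fst measurable_snd).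
have mxi2 : measurable_fun setT (fun p : R5 M * R5 M => p.1.2 : R).
  exact: (measurableT_comp measurable_snd measurable_fst).
under eq_fun do rewrite test_kernelE.
apply: measurable_funD; apply: measurable_funM.
- exact: (measurableT_comp mchi measurable_snd).
- apply: measurable_funM => //; exact: (measurableT_comp mf' mdot).
- exact: (measurableT_comp mf mdot).
- exact: (measurableT_comp mdz measurable_snd).
Qed.

Lemma test_kernel_le (C : R) xi x :
  (forall u, `|f u| <= 1) -> (forall u, `|f' u| <= 1) ->
  (forall x, `|chi x| <= C) -> (forall x, `|'D_e5 chi x| <= C) ->
  `|test_kernel chi f xi x| <= C * (1 + `|xi.2|).
Proof.
move=> f1 f1' C1 C2; rewrite test_kernelE (le_trans (ler_normD _ _))//.
rewrite mulrDr mulr1 addrC !normrM; apply: lerD.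
  by rewrite -[leRHS]mul1r ler_pM.
apply: ler_pM; rewrite ?mulr_ge0//.
by rewrite -[leRHS]mul1r ler_pM.
Qed.

End test_kernel_facts.

Lemma measurable_subcylinder (rho z1 z2 a b : R) :
  measurable (subcylinder rho z1 z2 a b : set (R3 M)).
Proof.
have -> : (subcylinder rho z1 z2 a b : set (R3 M)) =
    (`[0, rho]%classic : set M) `*` (`[z1, z2]%classic : set M) `*`
    (`[a, b]%classic : set M).
  apply/seteqP; split=> -[[r z] t] /=; rewrite !in_itv/=;
    by [case=> ? []|case=> -[]].
by apply: measurableX; [apply: measurableX|]; exact: measurable_itv.
Qed.

(** The kernels vanish off the support of [chi]. On it, for t in [a, b], the point lies in the
    cylinder and (|y|, z, t) in the subcylinder, so restricting [f] changes no pairing. *)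
Lemma sobolev_norm_radial (chi : R5 R -> R) (f : R3 R -> R)
    (rho w a b m t : R) :
  cutoff chi ->
  (forall x, tsupp chi x -> norm4 x.1 <= rho /\ `|x.2| <= w) ->
  a <= t <= b ->
  sobolev_norm (- m) (cutoff_mul chi (dz (distr_of_fun (radial_lift f t)))) =
  lift_norm (f \_ (subcylinder rho (- w) w a b))
    (test_kernel chi cos) (test_kernel chi (@sin R)) m t.
Proof.
move=> hchi Hs tab.
have Hc (g g' : R -> R) xi : (forall u : R, is_derive u 1 g (g' u)) ->
    (\int[leb5 R]_(x in @cylinder R)
      (radial_lift f t x * test_kernel chi g xi x)) =
    lift_pairing (f \_ (subcylinder rho (- w) w a b)) (test_kernel chi g) xi t.
  move=> dg; congr fine; rewrite integral_mkcond; apply: eq_integral => x _.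
  rewrite patchE; have [tx|ntx] := pselect (tsupp chi x); last first.
    by rewrite (test_kernel_out hchi dg) // !mulr0; case: ifP.
  have [_ _ /(_ x tx) xc] := hchi.
  rewrite mem_set// /radial_lift patchE mem_set//.
  have [x1 x2] := Hs x tx.
  rewrite /subcylinder /= norm4_ge0 x1 tab.
  by move: x2; rewrite ler_norml.
have E (g g' : R -> R) xi : (forall u : R, is_derive u 1 g (g' u)) ->
    (cutoff_mul chi (dz (distr_of_fun (radial_lift f t)))
      (fun x => g (dot5 xi x))) ^+ 2 =
    lift_pairing (f \_ (subcylinder rho (- w) w a b)) (test_kernel chi g) xi t
      ^+ 2.
  (* The sign in [dz] disappears in the square. *)
  by move=> dg; rewrite -(Hc _ _ _ dg); exact: sqrrN.
rewrite /sobolev_norm /lift_norm; congr (_ `^ _)%E.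
apply: eq_integral => xi _; congr EFin; rewrite /lift_sqnorm; congr (_ * _).
exact: (congr2 +%R (E _ _ xi (@is_derive_cos R)) (E _ _ xi (@is_derive_sin R))).
Qed.

(** Enlarging the time interval to the whole line gives the inequality; the rest is equality, by
    polar coordinates. *)
Lemma integral_lift_mass_subcylinder_le (f : R3 R -> R) (rho w a b : R) :
  measurable_fun setT (f \_ (subcylinder rho (- w) w a b) : R3 M -> R) ->
  (\int[leb1 R]_(t in `[a, b])
     lift_mass (f \_ (subcylinder rho (- w) w a b)) t <=
   (4 * fine (@ball4_volume R))%:E *
   \int[leb3 R]_(p in subcylinder rho (- w) w a b) (`|f p| * p.1.1 ^+ 3)%:E)%E.
Proof.
set K := subcylinder _ _ _ _ _ => mG.
have mK : measurable (K : set (R3 M)) := @measurable_subcylinder _ _ _ _ _.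
have mm := measurable_lift_mass mG.
have mab : measurable (`[a, b]%classic : set M) by exact: measurable_itv.
apply: (@le_trans _ _ (\int[leb1 R]_t lift_mass (f \_ K) t)%E).
  apply: ge0_subset_integral => //.
  by move=> t _; exact: lift_mass_ge0.
rewrite integral_lift_mass// -ge0_integralZl//; last 3 first.
- apply/measurable_EFinP; apply: measurable_funM.
    by apply: measurableT_comp => //; exact/(measurable_restrictT f mK).
  apply: measurable_funTS; apply: measurable_funX.
  exact: (measurableT_comp measurable_fst measurable_fst).
- by move=> p [/andP[p0 _] _]; rewrite lee_fin mulr_ge0// exprn_ge0.
- by rewrite lee_fin mulr_ge0// fine_ge0//; exact: measure_ge0.
rewrite [leRHS]integral_mkcond le_eqVlt; apply/orP; left; apply/eqP.
apply: eq_integral => p _.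
rewrite !patchE; case: ifPn => pK; last by rewrite normr0 mul0r.
(* On the subcylinder r >= 0, so the maximum is r. *)
rewrite /radial_density max_l; last by case/set_mem: pK => /andP[].
by rewrite -EFinM; congr EFin; ring.
Qed.

End main.

Theorem corollary7p4 (R : realType) (I : interval R)
    (F : nat -> R3 R -> R) :
  L1loc_cvg0 I (fun j p => F j p ^+ 2) ->
  forall m : R, 7 / 2 < m ->
  L1H_loc_cvg0 (- m) I
    (fun j t => dz (distr_of_fun (radial_lift (fun p => F j p ^+ 2) t))).
Proof.
move=> HF m hm chi a b hchi ab abI.
have [rho [w [rho01 /andP[w0 w1] Hs]]] := cutoff_tsupp_subcylinder hchi.
have Nw1 : - 1 < - w by rewrite ltrN2.
have Nww : - w <= w by lra.
have /= [mf iF cF] := HF rho (- w) w a b rho01 Nw1 Nww w1 ab abI.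
have [C [C0 C1 C2]] := cutoff_bounded hchi.
set K := subcylinder _ _ _ _ _ in mf iF cF.
pose f j (p : R3 R) := F j p ^+ 2.
have mK : measurable (K : set (R3 (measurableTypeR R))) :=
  @measurable_subcylinder _ _ _ _ _ _.
have mG j : measurable_fun setT (f j \_ K : R3 (measurableTypeR R) -> R).
  by apply/(measurable_restrictT (f j) mK); exact: mf.
have b1 xi x : `|test_kernel chi cos xi x| <= C * (1 + `|xi.2|).
  apply: (test_kernel_le hchi (@is_derive_cos R)) => // u; rewrite ?normrN.
    exact: cos_max.
  exact: sin_max.
have b2 xi x : `|test_kernel chi (@sin R) xi x| <= C * (1 + `|xi.2|).
  apply: (test_kernel_le hchi (@is_derive_sin R)) => // u.
    exact: sin_max.
  exact: cos_max.
have cNsin : continuous (fun u : R => - sin u).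
  by move=> u; apply: cvgN; exact: continuous_sin.
have m1 := measurable_test_kernel hchi (@is_derive_cos R) (@continuous_cos R)
  cNsin.
have m2 := measurable_test_kernel hchi (@is_derive_sin R) (@continuous_sin R)
  (@continuous_cos R).
pose sob j t := sobolev_norm (- m)
  (cutoff_mul chi (dz (distr_of_fun (radial_lift (f j) t)))).
pose N j := lift_norm (f j \_ K) (test_kernel chi cos)
  (test_kernel chi (@sin R)) m.
have sobE j t : t \in `[a, b]%classic -> sob j t = N j t.
  by rewrite inE/= in_itv/= => tab; exact: sobolev_norm_radial.
have mN j : measurable_fun setT (N j) := measurable_lift_norm (mG j) m1 m2 m.
have N0 j t : (0 <= N j t)%E by exact: poweR_ge0.
(* [D] depends on the cutoff and on [m] only, so the bound below is uniform in [j]. *)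
pose D := Num.sqrt (4 * C ^+ 2 * bracket5_integral m) + 1.
have D0 : 0 <= D by rewrite addr_ge0// sqrtr_ge0.
pose u j := (\int[leb3 R]_(p in K) (`|f j p| * p.1.1 ^+ 3)%:E)%E.
have mab : measurable (`[a, b]%classic : set (measurableTypeR R)).
  exact: measurable_itv.
have le_u j : (\int[leb1 R]_(t in `[a, b]) N j t <=
    (D * (4 * fine (@ball4_volume R)))%:E * u j)%E.
  have DE : (0 <= D%:E)%E by rewrite lee_fin.
  rewrite EFinM -muleA.
  apply: le_trans (lee_wpmul2l DE (integral_lift_mass_subcylinder_le (mG j))).
  rewrite -ge0_integralZl//; last 2 first.
  - by apply: measurable_funTS; exact: (measurable_lift_mass (mG j)).
  - by move=> t _; exact: lift_mass_ge0.
  apply: ge0_le_integral => //.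
  - exact: measurable_funTS.
  - apply: measurable_funTS; apply: emeasurable_funM => //.
    exact: (measurable_lift_mass (mG j)).
  - by move=> t _; exact: lift_norm_le.
(* As r >= 0 on [K], the integrand of [u j] is the absolute value of the function assumed
   integrable. *)
have u_lty j : (u j < +oo)%E.
  have /integrableP[_] := iF j; apply: le_lt_trans.
  rewrite le_eqVlt; apply/orP; left; apply/eqP; apply: eq_integral => p.
  rewrite inE => -[/andP[p0 _] _] /=.
  by congr EFin; rewrite [RHS]normrM (ger0_norm (exprn_ge0 3 p0)).
have u0 j : (0 <= u j)%E.
  apply: integral_ge0 => p [/andP[p0 _] _].
  by rewrite lee_fin mulr_ge0// exprn_ge0.
have int_sob j : (\int[leb1 R]_(t in `[a, b]) sob j t =
    \int[leb1 R]_(t in `[a, b]) N j t)%E.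
  by apply: eq_integral => t; exact: sobE.
(* The bound [le_u] serves twice: for fixed [j] it gives integrability in time, and as [j] grows it
   squeezes the integrals to 0. *)
split=> [j|].
  apply: (eq_integrable mab (N j)); first by move=> t tab; rewrite -sobE.
  apply/integrableP; split; first exact: measurable_funTS.
  under eq_integral do rewrite gee0_abs//.
  apply: le_lt_trans (le_u j) _.
  apply: lte_mul_pinfty => //.
  rewrite lee_fin mulr_ge0// mulr_ge0// fine_ge0//; exact: measure_ge0.
under eq_fun do rewrite -/(sob _ _).
apply: (@squeeze_cvge _ _ _ _ (cst 0%E) _
  (fun j => (D * (4 * fine (@ball4_volume R)))%:E * u j)%E).
- near=> j; rewrite -/(sob j) int_sob le_u andbT.
  by apply: integral_ge0.
- exact: cvg_cst.
- rewrite -[X in _ --> X](mule0 (D * (4 * fine (@ball4_volume R)))%:E).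
  exact: cvgeZl.
Unshelve. all: by end_near.
Qed.
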